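(* Let $(X,\mathcal{U})$ be a uniform space equipped with the uniform topology induced by $\mathcal{U}$, and let $x,y\in X$. Then $x\equiv y$ if and only if $(x,y)\in U$ for all $U\in\mathcal{U}$.
   Context: A filter on a set $Y$ is a collection $\mathcal{F}$ of subsets of $Y$ with $Y\in\mathcal{F}$, closed under supersets in $Y$ and under binary intersections. For $U,V\subseteq X\times X$ and $x_0\in X$, write $U^{-1}=\{(x,y)\mid(y,x)\in U\}$, $U\circ V=\{(x,z)\mid (x,y)\in U,\ (y,z)\in V\text{ for some }y\}$ and $U(x_0)=\{y\mid(x_0,y)\in U\}$. A uniformity on a set $X$ is a filter $\mathcal{U}$ on $X\times X$ such that for all $U\in\mathcal{U}$: (U1) $\{(x,x)\mid x\in X\}\subseteq U$; (U2) $U^{-1}\in\mathcal{U}$; (U3) there exists $V\in\mathcal{U}$ with $V\circ V\subseteq U$. The pair $(X,\mathcal{U})$ is then a uniform space. The uniform topology induced by $\mathcal{U}$ is the topology on $X$ whose open sets are the sets $T\subseteq X$ such that for all $x\in T$ there exists $U\in\mathcal{U}$ with $U(x)\subseteq T$. Points $x,y$ of a topological space are topologically indistinguishable, $x\equiv y$, if every open set containing $x$ contains $y$ and vice versa. *)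

(* Defs.v *)
From mathcomp Require Import all_boot all_order all_algebra.
From mathcomp Require Import all_classical topology.

Set Implicit Arguments.
Unset Strict Implicit.
Unset Printing Implicit Defensive.

Local Open Scope classical_set_scope.

Definition topologically_indistinguishable (X : topologicalType) (x y : X) :=
  forall O : set X, open O -> (O x <-> O y).

(* [uniformType] records the topology by its neighbourhood filters; its open
   sets are exactly those of the topology induced by the entourages. *)
Lemma open_uniformP (X : uniformType) (T : set X) :
  open T <->
  forall x, T x ->
    exists2 U : set (X * X), entourage U & [set y | U (x, y)] `<=` T.
Proof.
rewrite openE; split=> opT x Tx.
  have /nbhsP[U entU UT] : nbhs x T by exact: opT.
  by exists U => // y Uxy; apply/UT/xsectionP.
have [U entU UT] := opT x Tx.
by apply/nbhsP; exists U => // y /xsectionP; exact: UT.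
Qed.

(* Main.v *)
Require Import Defs.
From mathcomp Require Import all_boot all_order all_algebra.
From mathcomp Require Import all_classical topology.

(** The sections [U(x)] of the entourages form a neighbourhood base at [x].  If
    no open set separates [x] from [y], then [y] belongs to the interior of
    every [U(x)], which is an open set containing [x].  Conversely, an open set
    containing [x] contains some [U(x)], hence [y]; the condition on [(x, y)]
    is symmetric because entourages are stable under inversion. *)
Theorem theorem7p9 (X : uniformType) (x y : X) :
  topologically_indistinguishable x y <->
  (forall U : set (X * X), entourage U -> U (x, y)).
Proof.
split=> [xy U entU|xy O /open_uniformP opO].
  have Ux : interior (xsection U x) x by exact: nbhs_entourage.
  have /interior_subset/xsectionP// : interior (xsection U x) y.
  by apply/(xy _ (open_interior _)).
split=> [/opO[U entU]|/opO[U entU]]; apply; first exact: xy.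
exact: xy (entourage_inv entU).
Qed.
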